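(* Let $(L,\le)$ be a dual algebraic coframe such that $\mathcal{K}(L,\le)$ has a choice function. For every $x\in L$ and every $z\in L$ with $z\le x$, $$z=(z\wedge\mathtt{c}(x))\vee\bigvee_{\substack{s\in\delta(x)\\ s\le z}}s.$$
   Context: A filtered set is a nonempty poset in which any two elements have a common lower bound. An element $x$ of a poset $(L,\le)$ is dually compact if for every filtered $F\subset L$ having an infimum with $\bigwedge F\le x$ there is $f\in F$ with $f\le x$; $\mathcal{K}(L,\le)$ is the set of dually compact elements. A dual algebraic lattice is a lattice in which every subset has an infimum and every $x$ equals $\bigwedge F_x$ for some filtered $F_x\subset\mathcal{K}(L,\le)$. A coframe is a lattice in which every subset has an infimum and $x\vee\bigwedge_{s\in S}s=\bigwedge_{s\in S}(x\vee s)$ for all $x\in L$, $S\subset L$. A dual algebraic coframe is both. A choice function of a set $S$ is a map $\theta:\mathcal{P}(S)\setminus\{\emptyset\}\to S$ with $\theta(P)\in P$ for all $P$. $\mathcal{M}(x)$ is the set of maximal elements of $\{z\in L: z<x\}$; $\mu(x):=\bigwedge\mathcal{M}(x)$ if $\mathcal{M}(x)\ne\emptyset$, and $\mu(x):=x$ otherwise. Define $x^{(0)}:=x$, $x^{(\alpha+1)}:=\mu(x^{(\alpha)})$, and $x^{(\lambda)}:=\bigwedge_{\alpha<\lambda}x^{(\alpha)}$ for limit $\lambda$. $\mathtt{r}(x)$ is the least ordinal $\alpha$ with $x^{(\alpha)}=x^{(\alpha+1)}$, and $\mathtt{c}(x):=x^{(\mathtt{r}(x))}$ is the core of $x$. For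 $y\le x$, $x-y:=\bigwedge\{w\in L: w\le x,\ y\vee w=x\}$. The strata of $x$ are $\mathtt{s}_\alpha(x):=\{x^{(\alpha)}-m: m\in\mathcal{M}(x^{(\alpha)})\}$, and the boundary poset is $\delta(x):=\bigcup_\alpha\mathtt{s}_\alpha(x)$. The join of the empty set is the minimum of $L$. *)

(* Defs.v *)
From mathcomp Require Import all_boot all_order.
From mathcomp Require Import boolp classical_sets.

Set Implicit Arguments.
Unset Strict Implicit.
Unset Printing Implicit Defensive.

Import Order.TTheory.
Local Open Scope classical_set_scope.
Local Open Scope order_scope.

(** * Ordinals *)

(* [osup f] stands for the least ordinal strictly above all the [f a].  Every
   ordinal has such a presentation (von Neumann), but not a unique one:
   equality of ordinals is [oeq].  The universe of the index types [A] contains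
   the carriers of the lattices below (this is used in [rankP]), so there are
   ordinals longer than any chain in them.  Since [set T] is itself a lattice,
   forming [set Ord] would contradict this. *)
Inductive Ord := osup (A : Type) (f : A -> Ord).

Fixpoint ole (alpha beta : Ord) : Prop :=
  let: osup A f := alpha in let: osup B g := beta in
  forall a : A, exists b : B, ole (f a) (g b).

Definition olt (alpha beta : Ord) : Prop :=
  let: osup B g := beta in exists b : B, ole alpha (g b).

Definition oeq (alpha beta : Ord) : Prop := ole alpha beta /\ ole beta alpha.

Definition ozero : Ord := osup (fun a : False => match a with end).
Definition osucc (alpha : Ord) : Ord := osup (fun _ : unit => alpha).

Definition olimit (lam : Ord) : Prop :=
  olt ozero lam /\ forall alpha, olt alpha lam -> olt (osucc alpha) lam.

Lemma ole_refl alpha : ole alpha alpha.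
Proof. by elim: alpha => A f IH a; exists a; apply: IH. Qed.

Lemma ole_trans alpha beta gamma :
  ole alpha beta -> ole beta gamma -> ole alpha gamma.
Proof.
elim: alpha beta gamma => A f IH [B g] [C h] le1 le2 a.
have [b leb] := le1 a; have [c lec] := le2 b.
by exists c; apply: IH leb lec.
Qed.

Lemma oltP alpha beta : olt alpha beta <-> ole (osucc alpha) beta.
Proof. by case: beta => B g; split=> [h _ // | /(_ tt)]. Qed.

Lemma olt_osup A (f : A -> Ord) a : olt (f a) (osup f).
Proof. by exists a; apply: ole_refl. Qed.

Lemma olt_osucc alpha : olt alpha (osucc alpha).
Proof. by exists tt; apply: ole_refl. Qed.

Lemma ole_lt_trans alpha beta gamma :
  ole alpha beta -> olt beta gamma -> olt alpha gamma.
Proof. by case: gamma => C h le1 [c lec]; exists c; apply: ole_trans lec. Qed.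

Lemma olt_le_trans alpha beta gamma :
  olt alpha beta -> ole beta gamma -> olt alpha gamma.
Proof.
case: beta gamma => B g [C h] [b leb] /(_ b)[c lec].
by exists c; apply: ole_trans lec.
Qed.

Lemma oltW alpha beta : olt alpha beta -> ole alpha beta.
Proof.
elim: alpha beta => A f IH [B g] [b leb] a; exists b.
by apply: IH; apply: olt_le_trans leb; apply: olt_osup.
Qed.

Lemma olt_irr alpha : ~ olt alpha alpha.
Proof.
elim: alpha => A f IH [a lea]; apply: (IH a).
by apply: olt_le_trans lea; apply: olt_osup.
Qed.

Lemma ole_total alpha beta : ole alpha beta \/ olt beta alpha.
Proof.
elim: alpha beta => A f IH [B g].
have [[a nle]|all_le] := pselect (exists a, forall b, ~ ole (f a) (g b)).
  right; exists a; rewrite /ole -/ole; case: (f a) (IH a) nle => C h IHa nle b.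
  by have [/nle|] := IHa (g b).
left=> a; have [//|none] := pselect (exists b, ole (f a) (g b)).
by case: all_le; exists a => b leb; apply: none; exists b.
Qed.

Lemma ole0 alpha : ole ozero alpha.
Proof. by case: alpha => A f []. Qed.

Lemma olt_least (P : Ord -> Prop) :
  (exists alpha, P alpha) ->
  exists alpha, P alpha /\ forall beta, P beta -> ole alpha beta.
Proof.
move=> [alpha0 P0]; apply: contrapT => none.
suff nP gamma : forall alpha, ole alpha gamma -> ~ P alpha.
  by case: (nP alpha0 alpha0 (ole_refl _)).
elim: gamma => C h IH alpha lea Pa; apply: none; exists alpha.
split=> // beta Pb.
have [//|/olt_le_trans/(_ lea) [c lec]] := ole_total alpha beta.
by case: (IH c beta lec).
Qed.

(** * Dual algebraic coframes *)

Section OrderNotions.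
Context {d : Order.disp_t} {L : porderType d}.
Implicit Types (x y z : L) (S F : set L).

Definition filtered F : Prop :=
  F !=set0 /\
  forall x y, F x -> F y -> exists2 z, F z & z <= x /\ z <= y.

Definition dually_compact : set L := [set x | forall F m,
  filtered F -> infimums F m -> m <= x -> exists2 f, F f & f <= x].

Definition maximals S : set L :=
  [set m | S m /\ forall z, S z -> m <= z -> z = m].

End OrderNotions.

Definition has_choice_function (T : Type) (S : set T) : Prop :=
  exists theta : {P : set T | P `<=` S /\ P !=set0} -> T,
    forall P, (sval P) (theta P).

(* In a lattice with all infima, [\top] is the meet of the empty set and [\bot]
   is the minimum, so the [tbLatticeType] structure is no restriction.  As
   [infimum x0 set0 = x0] and [supremum x0 set0 = x0] in the library, the
   defaults [\top] and [\bot] below give the correct empty meet and join. *)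
Section Lattice.
Context {d : Order.disp_t} {L : tbLatticeType d}.
Implicit Types (x y z m : L) (S F : set L) (alpha beta : Ord).

Definition bigmeet S : L := infimum \top S.
Definition bigjoin S : L := supremum \bot S.

Definition mset x : set L := maximals [set z | z < x].

Definition mu x : L := if `[< mset x !=set0 >] then bigmeet (mset x) else x.

(* The iterate x^(alpha), by recursion on a presentation [osup f] of alpha:
   alpha is zero if the family [f] is empty, the successor of [f a] if [f a]
   is greatest in the family, and a limit otherwise, in which case the
   [f a] are cofinal in alpha.  Lemmas [iterate0], [iterateS], [iterate_lim]
   and [iterate_oeq] give the usual description. *)
Fixpoint iterate x alpha : L :=
  let: osup A f := alpha in
  if pselect (exists a : A, True) isn't left _ then x
  else if pselect (exists a, forall b, ole (f b) (f a)) is left amax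
    then mu (iterate x (f (sval (cid amax))))
  else bigmeet [set y | exists a, iterate x (f a) = y].

Definition is_rank x alpha : Prop :=
  iterate x alpha = iterate x (osucc alpha) /\
  forall beta, iterate x beta = iterate x (osucc beta) -> ole alpha beta.

(* The default [ozero] is never used when all infima exist, see [rankP]. *)
Definition rank x : Ord :=
  if pselect (exists alpha, is_rank x alpha) is left h then sval (cid h)
  else ozero.

Definition core x : L := iterate x (rank x).

(* The coframe difference x - y; only meant for [y <= x]. *)
Definition coframe_diff x y : L := bigmeet [set w | w <= x /\ y `|` w = x].

Definition stratum alpha x : set L :=
  [set coframe_diff (iterate x alpha) m | m in mset (iterate x alpha)].

Definition boundary x : set L := [set s | exists alpha, stratum alpha x s].

End Lattice.

Definition has_infima {d : Order.disp_t} (L : tbLatticeType d) : Prop :=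
  forall S : set L, infimums S !=set0.

Definition dual_algebraic_lattice {d : Order.disp_t} (L : tbLatticeType d) :
    Prop :=
  has_infima L /\
  forall x : L, exists F : set L,
    [/\ F `<=` dually_compact, filtered F & x = bigmeet F].

Definition coframe {d : Order.disp_t} (L : tbLatticeType d) : Prop :=
  has_infima L /\
  forall (x : L) (S : set L),
    x `|` bigmeet S = bigmeet [set x `|` s | s in S].

Definition dual_algebraic_coframe {d : Order.disp_t} (L : tbLatticeType d) :
    Prop :=
  dual_algebraic_lattice L /\ coframe L.

(** * Basic properties of the iterates *)

Section Iterates.
Context {d : Order.disp_t} {L : tbLatticeType d}.
Hypothesis infL : has_infima L.
Implicit Types (x y z m : L) (S F : set L) (alpha beta gamma : Ord).

Lemma bigmeetP S : infimums S (bigmeet S).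
Proof.
rewrite /bigmeet /infimum; case: eqP => [->|_].
  by split=> [x []|x _]; apply: lex1.
by have [y Sy] := infL S; apply: (xgetPex _ (ex_intro _ y Sy)).
Qed.

Lemma bigmeet_le S x : S x -> bigmeet S <= x.
Proof. by have [lb _] := bigmeetP S; apply: lb. Qed.

Lemma le_bigmeet S x : (forall y, S y -> x <= y) -> x <= bigmeet S.
Proof. by have [_ ub] := bigmeetP S => h; apply: ub. Qed.

Lemma bigjoinP S : supremums S (bigjoin S).
Proof.
rewrite /bigjoin /supremum; case: eqP => [->|_].
  by split=> [x []|x _]; apply: le0x.
suff: supremums S !=set0 by case=> y Sy; apply: (xgetPex _ (ex_intro _ y Sy)).
exists (bigmeet (ubound S)); split=> [x Sx|x ubx]; last exact: bigmeet_le.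
by apply: le_bigmeet => y; apply.
Qed.

Lemma mu_le x : mu x <= x.
Proof.
rewrite /mu; case: asboolP => // -[m Mm].
by apply: le_trans (bigmeet_le Mm) _; case: Mm => /ltW.
Qed.

Variant iterate_spec x A (f : A -> Ord) : L -> Prop :=
| IterZero of (A -> False) : iterate_spec x f x
| IterSucc a of (forall b, ole (f b) (f a)) :
    iterate_spec x f (mu (iterate x (f a)))
| IterLim of A & (forall a, exists b, olt (f a) (f b)) :
    iterate_spec x f (bigmeet [set y | exists a, iterate x (f a) = y]).

Lemma iterateP x A (f : A -> Ord) : iterate_spec x f (iterate x (osup f)).
Proof.
rewrite /=; case: pselect => [/cid[a0 _]|A0]; last first.
  by constructor=> a; apply: A0; exists a.
case: pselect => [amax|nmax]; first by constructor; case: (cid amax).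
constructor=> // a; have [//|none] := pselect (exists b, olt (f a) (f b)).
case: nmax; exists a => b; have [//|lt] := ole_total (f b) (f a).
by case: none; exists b.
Qed.

Lemma iterate0 x : iterate x ozero = x.
Proof. by case: iterateP => // [[]|[]]. Qed.

Lemma iterateS x alpha : iterate x (osucc alpha) = mu (iterate x alpha).
Proof.
case: iterateP => [/(_ tt)//|//|_ /(_ tt)[_ ]].
by move/olt_irr.
Qed.

Lemma iterate_le_start x alpha : iterate x alpha <= x.
Proof.
elim: alpha => A f IH; case: iterateP => [//|a _|a _].
  exact: le_trans (mu_le _) (IH a).
by apply: le_trans (IH a); apply: bigmeet_le; exists a.
Qed.

Lemma iterate_anti x alpha beta :
  ole alpha beta -> iterate x beta <= iterate x alpha.
Proof.
move=> leab; move: {2}beta (ole_refl beta) => gamma; move: alpha beta leab.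
elim: gamma => C h IHc alpha beta leab lebc.
have {IHc} IH al be : ole al be -> olt be beta -> iterate x be <= iterate x al.
  by move=> le1 /olt_le_trans/(_ lebc)[c lec]; apply: (IHc c).
case: beta leab {lebc} IH => B g leab IH.
have below b al : ole al (g b) -> iterate x (osup g) <= iterate x al.
  move=> lea; case: iterateP => [/(_ b)//|b0 maxb0|_ _].
    apply: le_trans (mu_le _) (IH _ _ _ (olt_osup g b0)).
    exact: ole_trans lea (maxb0 b).
  apply: le_trans (IH _ _ lea (olt_osup g b)).
  by apply: bigmeet_le; exists b.
case: alpha leab => A f leab; case: (iterateP x f) => [_|a maxa|a0 lim].
- exact: iterate_le_start.
- have [b leb] := leab a.
  have [ltb|geb] := pselect (exists b', olt (g b) (g b')).
    case: ltb => b' /(ole_lt_trans leb)/oltP; rewrite -iterateS.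
    exact: below.
  have maxb b' : ole (g b') (g b).
    have [//|lt] := ole_total (g b') (g b).
    by case: geb; exists b'.
  have [leba|/oltP lta] := ole_total (g b) (f a); last first.
    by rewrite -iterateS; apply: below lta.
  case: iterateP => [/(_ b)//|b0 maxb0|_ lim]; last first.
    have [b' /olt_le_trans/(_ (maxb b'))] := lim b.
    by move/olt_irr.
  suff -> : iterate x (g b0) = iterate x (f a) by [].
  have le1 : ole (f a) (g b0) := ole_trans leb (maxb0 b).
  have le2 : ole (g b0) (f a) := ole_trans (maxb b0) leba.
  apply/le_anti/andP; split; first exact: IH le1 (olt_osup g b0).
  by apply: IH le2 _; exists b.
- apply: le_bigmeet => _ [a <-].
  by have [b leb] := leab a; apply: below leb.
Qed.

Lemma iterate_oeq x alpha beta :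
  oeq alpha beta -> iterate x alpha = iterate x beta.
Proof.
by case=> le1 le2; apply/le_anti/andP; split; apply: iterate_anti.
Qed.

Lemma iterate_lim x lam : olimit lam ->
  iterate x lam =
  bigmeet [set y | exists2 alpha, olt alpha lam & iterate x alpha = y].
Proof.
case=> lt0 ltS; apply/le_anti/andP; split.
  by apply: le_bigmeet => _ [alpha lta <-]; apply/iterate_anti/oltW.
case: lam lt0 ltS => A f lt0 ltS; case: iterateP => [A0|a maxa|_ _].
- by case: lt0 => a; case: (A0 a).
- have /ltS[b leb] := olt_osup f a.
  by case: (@olt_irr (f a)); apply/oltP; apply: ole_trans leb (maxa b).
- apply: le_bigmeet => _ [a <-]; apply: bigmeet_le.
  by exists (f a) => //; apply: olt_osup.
Qed.

Lemma rankP x : is_rank x (rank x).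
Proof.
rewrite /rank; case: pselect => [h|none]; first by case: (cid h).
case: none; apply: olt_least.
apply: contrapT => nstab.
have lt_iter alpha beta : olt alpha beta -> iterate x beta < iterate x alpha.
  move=> /oltP/(iterate_anti x)/le_lt_trans; apply.
  rewrite lt_neqAle iterateS mu_le andbT -iterateS; apply/eqP => eqa.
  by apply: nstab; exists alpha.
pose pre (y : L) : Ord :=
  if pselect (exists alpha, iterate x alpha = y) is left h then sval (cid h)
  else ozero.
pose theta := @osup L pre.
have preK : iterate x (pre (iterate x theta)) = iterate x theta.
  rewrite /pre; case: pselect => [h|[]]; first by case: (cid h).
  by exists theta.
by have := lt_iter _ _ (@olt_osup L pre (iterate x theta)); rewrite preK ltxx.
Qed.

End Iterates.

(* Main.v *)
Require Import Defs.
From mathcomp Require Import all_boot all_order.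
From mathcomp Require Import boolp classical_sets.

Set Implicit Arguments.
Unset Strict Implicit.
Unset Printing Implicit Defensive.

Local Open Scope classical_set_scope.
Local Open Scope order_scope.

Import Order.TTheory.

(** Let [w] be the join of the boundary elements of [x] below [z].  The proof
  shows [z <= y `|` w] for every iterate [y] of [x], by induction on the
  ordinal; at the core this gives the theorem after meeting with [z], because a
  coframe is a distributive lattice.

  The induction starts at [z <= x].  Since [_ `|` w] commutes with meets, limit
  stages are immediate, and at a successor stage with [mset y] nonempty it
  suffices to show [z <= m `|` w] for each [m] in [mset y] ([le_join_mset]).
  Maximality of [m] leaves two possibilities for [z `&` y].  If it lies below
  [m], then [z <= (z `&` y) `|` w <= m `|` w].  Otherwise its join with [m] is
  [y], so the difference [y - m], the least element below [y] having that join,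
  lies below [z]; it is then one of the joinands of [w], and
  [y <= m `|` (y - m) <= m `|` w]. *)

Section Coframe.
Context {d : Order.disp_t} {L : tbLatticeType d}.
Hypothesis cofL : coframe L.
Implicit Types (x y z m u w : L) (S : set L).

Let infL : has_infima L := proj1 cofL.

Lemma le_bigjoin S x : S x -> x <= bigjoin S.
Proof. by have [ub _] := bigjoinP infL S; apply: ub. Qed.

Lemma bigjoin_le S x : (forall y, S y -> y <= x) -> bigjoin S <= x.
Proof. by have [_ lub] := bigjoinP infL S => h; apply: lub. Qed.

Lemma le_join_bigmeet S w z :
  (forall y, S y -> z <= y `|` w) -> z <= bigmeet S `|` w.
Proof.
move=> zle; rewrite joinC (proj2 cofL).
by apply: (le_bigmeet infL) => _ [y Sy <-]; rewrite joinC zle.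
Qed.

(** Finite distributivity, obtained from the infinite law for the meet of a
  pair. *)
Lemma le_joinI u v w z : z <= u `|` w -> z <= v `|` w -> z <= (u `&` v) `|` w.
Proof.
move=> zu zv.
have /le_trans : z <= bigmeet [set u; v] `|` w.
  by apply: le_join_bigmeet => _ [] ->.
by apply; rewrite leU2// lexI !(bigmeet_le infL); [|right|left].
Qed.

Lemma le_meetU z u w : z <= u `|` w -> z <= (z `&` u) `|` w.
Proof. by move=> zu; apply: le_joinI => //; apply: leUl. Qed.

Lemma le_join_coframe_diff y m : y <= m `|` coframe_diff y m.
Proof.
rewrite joinC; apply: le_join_bigmeet => w [_ <-].
by rewrite joinC.
Qed.

(** By maximality of [m], the join [m `|` u] is either [m], so that [u <= m],
  or [y], so that [u] is one of the elements whose meet is [y - m]. *)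
Lemma mset_dichotomy y m u :
  mset y m -> u <= y -> u <= m \/ coframe_diff y m <= u.
Proof.
move=> [my max_m] uy; have [|nlt] := boolP (m `|` u < y).
  by move=> /max_m/(_ (leUl _ _)) <-; left; apply: leUr.
right; apply: (bigmeet_le infL); split=> //; apply/eqP.
by move: nlt; rewrite lt_neqAle negb_and negbK leUx (ltW my) uy orbF.
Qed.

(** The successor step.  With [w] the join of the boundary elements below [z],
  the hypothesis on [y - m] holds as soon as [y - m] is a boundary element. *)
Lemma le_join_mset y m w z :
  mset y m -> (coframe_diff y m <= z -> coframe_diff y m <= w) ->
  z <= y `|` w -> z <= m `|` w.
Proof.
move=> Mm diff_le zyw.
have [zym|] := mset_dichotomy Mm (leIr y z).
  by apply: le_trans (le_meetU zyw) _; rewrite leU2.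
rewrite lexI => /andP[/diff_le sw _].
apply: le_trans zyw _; rewrite leUx leUr andbT.
by apply: le_trans (le_join_coframe_diff y m) _; rewrite leU2.
Qed.

Lemma le_iterate_join_boundary x z alpha : z <= x ->
  z <= iterate x alpha `|` bigjoin [set s | boundary x s /\ s <= z].
Proof.
move=> zx; elim: alpha => A f IH; case: iterateP => [_|a _|_ _].
- by rewrite lexU2// zx.
- rewrite /mu; case: asboolP => // _.
  apply: le_join_bigmeet => m Mm; apply: le_join_mset (IH a) => // sz.
  by apply: le_bigjoin; split=> //; exists (f a), m.
- by apply: le_join_bigmeet => _ [a <-].
Qed.

End Coframe.

Theorem lemma4p28 (d : Order.disp_t) (L : tbLatticeType d)
    (hL : dual_algebraic_coframe L)
    (hK : has_choice_function (@dually_compact d L))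
    (x z : L) (hzx : z <= x) :
  z = (z `&` core x) `|` bigjoin [set s | boundary x s /\ s <= z].
Proof.
have [_ cofL] := hL; apply/le_anti/andP; split.
  by apply: le_meetU => //; apply: le_iterate_join_boundary.
by rewrite leUx leIl; apply: bigjoin_le => // s [].
Qed.
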